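(* Let $X$ and $Y$ be Hilbert spaces, let $\Theta_1,\Theta_2\subset X\times Y$ be locally closed around $(\bar x,\bar y)\in\Theta_1\cap\Theta_2$, and let $\Pi_X(\Theta_1\cup\Theta_2)\subset\Omega$ for some closed and convex set $\Omega\subset X$. Fix $\varepsilon\in(0,1)$ and let $(x^*,y^* )\in\widehat N^c_\varepsilon\big((\bar x,\bar y);\Theta_1\cap\Theta_2\big)\cap[T(\bar x;\Omega)\times Y]$. Then for any $\nu>0$ there exist $\lambda\ge0$, $(x_i,y_i)\in\Theta_i\cap[(\bar x+\nu B_X)\times(\bar y+\nu B_Y)]$, and $$(x_i^*,y_i^* )\in\big[\widehat N\big((x_i,y_i);\Theta_i\big)+(\|(x^*,y^* )\|_{X\times Y}+\nu)\varepsilon(B_X\times B_Y)\big]\cap[T(x_i;\Omega)\times Y],\quad i=1,2,$$ such that $$\lambda(x^*,y^* )-(x_1^*,y_1^* )-(x_2^*,y_2^* )\in\nu(B_X\times B_Y)\quad\text{and}\quad\max\{\lambda,\|(x_1^*,y_1^* )\|_{X\times Y}\}=1.$$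
   Context: Hilbert spaces are identified with their duals; products carry the norm $\|(x,y)\|_{X\times Y}=\sqrt{\|x\|^2+\|y\|^2}$. $B_X,B_Y$ are closed unit balls, and $\Pi_X$ is the projection of $X\times Y$ onto $X$. Tangent (contingent) cone: $w\in T(\bar x;\Omega)$ iff there are $t_k>0$, $t_k\to0$, $w_k\to w$ with $\bar x+t_kw_k\in\Omega$ for all $k$. For $\varepsilon\ge0$, $\Lambda\subset Z$, $\bar z\in\Lambda$, the $\varepsilon$-regular normal cone is $\widehat N^c_\varepsilon(\bar z;\Lambda)=\{z^*\in Z^*\mid\limsup_{z\to\bar z,\,z\in\Lambda}\frac{\langle z^*,z-\bar z\rangle}{\|z-\bar z\|}\le\varepsilon\|z^*\|\}$ (limsup over $z\ne\bar z$; vacuous if $\bar z$ is isolated in $\Lambda$), and $\widehat N(\bar z;\Lambda)=\widehat N^c_0(\bar z;\Lambda)$ is the regular normal cone. *)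

(* Defs.v *)
From HB Require Import structures.
From mathcomp Require Import all_boot all_order all_algebra.
From mathcomp Require Import all_classical all_reals all_analysis.

Set Implicit Arguments.
Unset Strict Implicit.
Unset Printing Implicit Defensive.

Import Order.TTheory GRing.Theory Num.Theory.
Import numFieldNormedType.Exports.

Local Open Scope classical_set_scope.
Local Open Scope ring_scope.

(* Real Hilbert spaces: Banach spaces whose norm comes from an inner product. *)
HB.mixin Record CompleteNormedModule_isHilbert (R : realType) X
    of CompleteNormedModule R X := {
  inner : {dot X for (@idfun R)} ;
  normr_inner : forall x : X, `|x| = Num.sqrt (inner x x) }.

#[short(type="hilbertType")]
HB.structure Definition Hilbert (R : realType) :=
  {X of CompleteNormedModule R X & CompleteNormedModule_isHilbert R X}.

Section Cones.
Context {R : realType}.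

Definition tangent_cone {X : normedModType R} (x : X) (Omega : set X) : set X :=
  [set w | exists (t : R ^nat) (u : X ^nat),
    [/\ forall k, 0 < t k,
        t @ \oo --> (0 : R),
        u @ \oo --> w &
        forall k, Omega (x + t k *: u k)]].

Context {X Y : hilbertType R}.

(* The library's norm on X * Y is the sup norm. It induces the same topology
   as the Hilbert norm prod_norm, so nbhs, closed and dnbhs below are the
   intended ones. The dual of X * Y is identified with X * Y via prod_inner. *)
Definition prod_norm (z : X * Y) : R := Num.sqrt (`|z.1| ^+ 2 + `|z.2| ^+ 2).

Definition prod_inner (z z' : X * Y) : R :=
  inner z.1 z'.1 + inner z.2 z'.2.

Definition locally_closed_at (z : X * Y) (Theta : set (X * Y)) : Prop :=
  exists2 U, nbhs z U & closed (Theta `&` closure U).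

(* If z is isolated in L, the filter contains set0, the limsup is -oo and the
   condition is vacuous. *)
Definition eps_normal_cone (eps : R) (z : X * Y) (L : set (X * Y)) :
    set (X * Y) :=
  [set zs | (limf_esup
      (fun z' : X * Y => (prod_inner zs (z' - z) / prod_norm (z' - z))%:E)
      (within L z^') <= (eps * prod_norm zs)%:E)%E].

Definition normal_cone : X * Y -> set (X * Y) -> set (X * Y) :=
  eps_normal_cone 0.

End Cones.

Definition minkowski_sum {V : zmodType} (A B : set V) : set V :=
  [set a + b | a in A & b in B].

(* Main.v *)
(** Penalize the constraint [z1 = z2] together with the failure of
    [h z <= 0], where [h z = c sqrt(|z - zb|^2 + tau^2) - <z*, z - zb>] and [c]
    is slightly larger than [eps |z*|]: the function
      [phi(z1, z2) = sqrt(|z1 - z2|^2 + max(h z2, 0)^2)]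
    is positive on [Theta1 x Theta2] near [(zb, zb)], because [h > 0] on
    [Theta1 /\ Theta2], while [phi(zb, zb) = c tau] is as small as we like. The
    Borwein-Preiss principle gives a minimizer of [phi] plus a small smooth
    quadratic, and differentiating in [z1] and [z2] separately gives proximal
    normals [mu (z2 - z1)] and [mu (z1 - z2) + l z*] up to small errors, with
    [mu = 1 / phi], [l = max(h z2, 0) / phi] and [l^2 + mu^2 |z1 - z2|^2 = 1].
    Since [Omega] is convex, [x2 - x1] and [x1 - x2] are tangent to it at [x1] and
    [x2]. The remaining term [x*] is tangent only at [xb]; it is replaced by
    [(xb + t w - x2) / t] with [xb + t w] in [Omega], [w] close to [x*] and
    [|x2 - xb|] much smaller than [t]. *)

Require Import Defs.
From HB Require Import structures.
From mathcomp Require Import all_boot all_order all_algebra.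
From mathcomp Require Import all_classical all_reals all_analysis.
From mathcomp Require Import ring lra.
Set Implicit Arguments.
Unset Strict Implicit.
Unset Printing Implicit Defensive.

Import Order.TTheory GRing.Theory Num.Theory.
Import numFieldNormedType.Exports.
Local Open Scope classical_set_scope.
Local Open Scope ring_scope.

(** * Quadratic forms equivalent to the squared norm, and completeness of products *)

Definition seq_complete {R : realType} (V : normedModType R) : Prop :=
  forall u : V ^nat,
    (forall e : R, 0 < e ->
      exists N, forall n, (N <= n)%N -> `|u N - u n| <= e) ->
    cvgn u.

(* The library norm of a product is the sup norm, so a Hilbert structure is a
   form whose quadratic form is only equivalent to the squared norm. *)
Record hilbert_form {R : realType} {V : normedModType R} (B : V -> V -> R)
    : Prop := HilbertForm {
  hformDl : forall x y z, B (x + y) z = B x z + B y z ;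
  hformZl : forall a x z, B (a *: x) z = a * B x z ;
  hformC : forall x y, B x y = B y x ;
  hform_ge : forall x, `|x| ^+ 2 <= B x x ;
  hform_le : exists2 C, 0 <= C & forall x, B x x <= C * `|x| ^+ 2 }.

Section HilbertForm.
Context {R : realType} {V : normedModType R} {B : V -> V -> R}.
Hypothesis hB : hilbert_form B.

Lemma hformDr x y z : B z (x + y) = B z x + B z y.
Proof. by rewrite hformC// hformDl// !(hformC hB z). Qed.

Lemma hformZr a x z : B z (a *: x) = a * B z x.
Proof. by rewrite hformC// hformZl// (hformC hB z). Qed.

Lemma hform0l x : B 0 x = 0.
Proof. by rewrite -(scale0r 0) hformZl// mul0r. Qed.

Lemma hformNl x z : B (- x) z = - B x z.
Proof. by rewrite -scaleN1r hformZl// mulN1r. Qed.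

Lemma hformNr x z : B z (- x) = - B z x.
Proof. by rewrite -scaleN1r hformZr mulN1r. Qed.

Lemma hformBl x y z : B (x - y) z = B x z - B y z.
Proof. by rewrite hformDl// hformNl. Qed.

Lemma hformBr x y z : B z (x - y) = B z x - B z y.
Proof. by rewrite hformDr hformNr. Qed.

Lemma hform_ge0 x : 0 <= B x x.
Proof. by apply: le_trans (hform_ge hB x); rewrite exprn_ge0. Qed.

(** Moving the centre of a squared distance from [y] to [v] only costs an affine term. This lets
    sums of squared distances to different points be read as one quadratic at [v] plus a
    gradient. *)
Lemma hform_expand x y v :
  B (x - y) (x - y) = B (x - v) (x - v) + 2 * B (v - y) (x - v) + B (v - y) (v - y).
Proof.
rewrite !(hformBl, hformBr) (hformC hB v x) (hformC hB y x) (hformC hB y v).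
ring.
Qed.

Lemma hform_CS x y : B x y ^+ 2 <= B x x * B y y.
Proof.
have [x0|x0] := eqVneq x 0.
  by rewrite x0 !hform0l expr0n/= mul0r.
have Bx : 0 < B x x.
  by apply: lt_le_trans (hform_ge hB x); rewrite exprn_gt0// normr_gt0.
have := hform_ge0 (B x x *: y - B x y *: x).
rewrite !(hformBl, hformBr) !(hformZl hB) !hformZr (hformC hB y x).
rewrite [leRHS](_ : _ = B x x * (B x x * B y y - B x y ^+ 2)); last by ring.
by rewrite pmulr_rge0// subr_ge0.
Qed.

Lemma hform_le_norm : exists2 C, 0 <= C & forall x y, `|B x y| <= C * (`|x| * `|y|).
Proof.
have [C C0 hC] := hform_le hB; exists C => // x y.
rewrite -(ler_sqr (x := `|B x y|)) ?nnegrE ?mulr_ge0// real_normK ?num_real//.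
apply: le_trans (hform_CS x y) _.
have -> : (C * (`|x| * `|y|)) ^+ 2 = (C * `|x| ^+ 2) * (C * `|y| ^+ 2) by ring.
by apply: ler_pM => //; exact: hform_ge0.
Qed.

Lemma hform_continuous a : continuous (B a).
Proof.
have [C C0 hC] := hform_le_norm.
move=> x; apply/cvgrPdist_le => e e0.
have d0 : 0 < e / (C * `|a| + 1) by rewrite divr_gt0// ltr_wpDl// mulr_ge0.
near=> y.
rewrite -hformBr; apply: le_trans (hC _ _) _.
have : `|x - y| <= e / (C * `|a| + 1).
  by near: y; exact: (@cvgr_dist_le _ _ _ _ _ id x cvg_id).
rewrite ler_pdivlMr; last by rewrite ltr_wpDl// mulr_ge0.
move=> h; apply: le_trans h.
have := normr_ge0 (x - y); nra.
Unshelve. all: by end_near. Qed.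

Lemma hform_sq_continuous : continuous (fun x => B x x).
Proof.
have [C C0 hC] := hform_le_norm.
move=> x; apply/cvgrPdist_le => e e0.
pose K := C * (2 * `|x| + 1).
have K0 : 0 <= K by rewrite mulr_ge0// addr_ge0// mulr_ge0.
have d0 : 0 < e / (K + 1) by rewrite divr_gt0// ltr_wpDl.
near=> y.
have -> : B x x - B y y = B (x - y) (x + y).
  by rewrite !(hformBl, hformDr) (hformC hB y x); ring.
have : `|x - y| <= Num.min 1 (e / (K + 1)).
  near: y; apply: (@cvgr_dist_le _ _ _ _ _ id x cvg_id).
  by rewrite lt_min ltr01.
rewrite le_min ler_pdivlMr ?ltr_wpDl// => /andP[h1 h2].
have h3 : `|x + y| <= 2 * `|x| + 1.
  have -> : x + y = 2 *: x - (x - y).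
    by rewrite scaler_nat mulr2n opprB -addrA [x + (y - x)]addrC subrK.
  by rewrite (le_trans (ler_normB _ _))// normrZ ger0_norm// lerD.
apply: le_trans (hC _ _) _; apply: le_trans h2.
rewrite mulrCA; apply: ler_wpM2l => //.
by apply: (@le_trans _ _ K); [exact: ler_wpM2l|rewrite lerDl].
Unshelve. all: by end_near. Qed.

End HilbertForm.

Lemma inner_form {R : realType} (X : hilbertType R) :
  hilbert_form (fun x y : X => inner x y).
Proof.
have Cxy (x y : X) : inner x y = inner y x.
  by rewrite (hermC (inner : {dot X for @idfun R})) /= expr0 mul1r.
have sq (x : X) : `|x| ^+ 2 = inner x x.
  rewrite normr_inner sqr_sqrtr//.
  have [->|x0] := eqVneq x 0; first by rewrite linear0r.
  by rewrite ltW// neq0_dnorm_gt0.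
split=> //.
- by move=> x y z; rewrite linearDl.
- by move=> a x z; rewrite linearZl_LR.
- by move=> x; rewrite sq.
- by exists 1 => // x; rewrite mul1r sq.
Qed.

Lemma prod_form {R : realType} {V W : normedModType R}
    (B : V -> V -> R) (D : W -> W -> R) :
  hilbert_form B -> hilbert_form D ->
  hilbert_form (fun x y : V * W => B x.1 y.1 + D x.2 y.2).
Proof.
move=> hB hD; split.
- by move=> x y z; rewrite /= (hformDl hB) (hformDl hD); ring.
- by move=> a x z; rewrite /= (hformZl hB) (hformZl hD); ring.
- by move=> x y; rewrite (hformC hB) (hformC hD).
- move=> x; rewrite prod_normE; have := hform_ge hB x.1; have := hform_ge hD x.2.
  have := hform_ge0 hB x.1; have := hform_ge0 hD x.2.
  by case: (leP `|x.1| `|x.2|) => _; lra.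
- have [C C0 hC] := hform_le hB; have [E E0 hE] := hform_le hD.
  exists (C + E); first exact: addr_ge0.
  move=> x; rewrite mulrDl; apply: lerD.
    apply: le_trans (hC _) _; apply: ler_wpM2l => //.
    by rewrite ler_sqr ?nnegrE// prod_normE le_max lexx.
  apply: le_trans (hE _) _; apply: ler_wpM2l => //.
  by rewrite ler_sqr ?nnegrE// prod_normE le_max lexx orbT.
Qed.

Lemma complete_seq_complete {R : realType} (V : completeNormedModType R) :
  seq_complete V.
Proof.
move=> u hu; apply: cauchy_cvg; apply/cauchy_exP => e e0.
have [N hN] := hu (e / 2) (divr_gt0 e0 (ltr0Sn _ _)).
exists (u N); exists N => // n /= Nn; rewrite -ball_normE /=.
by apply: le_lt_trans (hN n Nn) _; rewrite ltr_pdivrMr// ltr_pMr// ltr1n.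
Qed.

Lemma prod_seq_complete {R : realType} (V W : normedModType R) :
  seq_complete V -> seq_complete W -> seq_complete (V * W)%type.
Proof.
move=> cV cW u hu.
have c1 : cvgn (fun n => (u n).1).
  apply: cV => e /hu[N hN]; exists N => n /hN; apply: le_trans.
  by rewrite prod_normE le_max lexx.
have c2 : cvgn (fun n => (u n).2).
  apply: cW => e /hu[N hN]; exists N => n /hN; apply: le_trans.
  by rewrite prod_normE le_max lexx orbT.
apply/cvg_ex; exists (limn (fun n => (u n).1), limn (fun n => (u n).2)).
rewrite (_ : u = fun n => ((u n).1, (u n).2)).
  exact: cvg_pair.
by apply/funext => n; case: (u n).
Qed.

(** * Smooth variational principle *)

(** If an [e]-minimizer supplied by the infimum is worse than [x], then [x] is itself an
    [e]-minimizer. *)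
Lemma near_minimizer {R : realType} (T : Type) (S : set T) (G : T -> R)
    (m e : R) (x : T) :
  (forall z, S z -> m <= G z) -> 0 < e -> S x ->
  exists y, [/\ S y, G y <= G x & forall z, S z -> G y <= G z + e].
Proof.
move=> Gm e0 Sx.
have hI : has_inf (G @` S).
  by split; [exists (G x), x|exists m => _ [z Sz <-]; exact: Gm].
have infle z : S z -> inf (G @` S) <= G z.
  by move=> Sz; apply: ge_inf; [exact: hI.2|exists z].
have [_ [y Sy <-] yI] := inf_adherent e0 hI.
have [xy|/ltW yx] := leP (G x) (G y); [exists x|exists y]; split=> // z Sz.
- by rewrite (le_trans xy)// (le_trans (ltW yI))// lerD2r infle.
- by rewrite (le_trans (ltW yI))// lerD2r infle.
Qed.

(* Borwein-Preiss: each [x n.+1] nearly minimizes the objective perturbed by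
   small multiples of the squared distances to [x 0], ..., [x n]. The total
   perturbation is again quadratic, so only its gradient [b] at the limit
   matters. *)
Lemma smooth_variational {R : realType} (V : normedModType R)
    (B : V -> V -> R) (S : set V) (f : V -> R) (m k r : R) (x0 : V) :
  hilbert_form B -> seq_complete V -> closed S -> continuous f ->
  (forall x, S x -> m <= f x) -> S x0 -> 0 < k -> 0 < r ->
  f x0 <= m + k * r / 2 ->
  exists (v b : V) (d : R), [/\ S v, `|x0 - v| <= r, `|b| <= k &
    forall x, S x -> f v <= f x + d * B (x - v) (x - v) + 2 * B b (x - v)].
Proof.
move=> hB cV cS cf fm Sx0 k0 r0 fx0.
(* The penalty of stage [n] has weight [d * h n]; the weights sum to [2 * d], and [2 * d * r = k] is
   the bound wanted on the gradient. *)
pose d := k / (2 * r).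
have d0 : 0 < d by rewrite divr_gt0// mulr_gt0.
have dr : 2 * d * r = k by rewrite /d; field; rewrite gt_eqF.
pose h n : R := 2^-1 ^+ n.
have h0 n : 0 < h n by rewrite exprn_gt0// invr_gt0.
have hS n : h n.+1 = h n / 2 by rewrite /h exprS mulrC.
have h1 n : h n <= 1.
  by rewrite exprn_ile1// ?invr_ge0// invf_le1// ler1n.
have hlim : h n @[n --> \oo] --> (0 : R).
  by apply: cvg_expr; rewrite ger0_norm ?invr_ge0// invf_lt1// ltr1n.
(* The tolerance [e n] equals the penalty of stage [n] at distance [r * h n], which confines the
   later iterates to that radius. Also [e 0 = k * r / 2], the gap granted to [x0]. *)
pose e n := d * h n * (r * h n) ^+ 2.
have e0 n : 0 < e n by apply: mulr_gt0; [exact: mulr_gt0|apply/exprn_gt0/mulr_gt0].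
have ele n : e n <= d * r ^+ 2 * h n.
  rewrite [leLHS](_ : _ = d * r ^+ 2 * h n * h n ^+ 2); last by rewrite /e; ring.
  apply: ler_piMr; last by apply: exprn_ile1 => //; exact: ltW.
  by rewrite mulr_ge0 ?ltW// mulr_gt0// exprn_gt0.
(* Choice needs a total selection, so the hypotheses are moved inside; where they fail, any point
   will do. *)
have hsel : forall p : (V -> R) * V * nat, exists y : V,
    (forall z, S z -> m <= p.1.1 z) -> S p.1.2 ->
    [/\ S y, p.1.1 y <= p.1.1 p.1.2 &
      forall z, S z -> p.1.1 y <= p.1.1 z + e p.2].
  move=> [[G x] n] /=.
  have [[Gm Sx]|nh] := pselect ((forall z, S z -> m <= G z) /\ S x).
    by have [y hy] := near_minimizer Gm (e0 n) Sx; exists y.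
  by exists x => Gm Sx; case: nh.
have [sel selP] := choice hsel.
pose next (n : nat) (p : (V -> R) * V) : (V -> R) * V :=
  let G := fun y => p.1 y + d * h n * B (y - p.2) (y - p.2) in
  (G, sel (G, p.2, n.+1)).
pose st := fix st n := if n is n'.+1 then next n' (st n') else (f, x0).
pose F n := (st n).1; pose x n := (st n).2.
have FS n y : F n.+1 y = F n y + d * h n * B (y - x n) (y - x n) by [].
have dh0 n : 0 < d * h n by rewrite mulr_gt0.
have F_le n y : F n y <= F n.+1 y.
  by rewrite FS lerDl; apply: mulr_ge0; [exact: ltW|exact: hform_ge0].
have Fm n z : S z -> m <= F n z.
  move=> Sz; elim: n => [|n ih]; first exact: fm.
  exact: le_trans ih (F_le _ _).
have selS n : S (x n) -> [/\ S (x n.+1), F n.+1 (x n.+1) <= F n.+1 (x n) &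
    forall z, S z -> F n.+1 (x n.+1) <= F n.+1 z + e n.+1].
  by move=> Sx; apply: (selP (F n.+1, x n, n.+1)) => //= z; exact: Fm.
have Sx n : S (x n) by elim: n => [//|n /selS[]].
have xmin n z : S z -> F n (x n) <= F n z + e n.
  case: n => [|n] Sz; last by have [_ _] := selS n (Sx n); apply.
  rewrite (le_trans fx0)// lerD ?fm// /e /h expr0 !mulr1 -dr.
  by rewrite [leRHS](_ : _ = 2 * d * r * r / 2)//; field.
have Fx_anti i j : (i <= j)%N -> F j (x j) <= F i (x i).
  move=> /subnK <-; elim: (j - i)%N => [//|n]; apply: le_trans.
  rewrite addSn; have [_ + _] := selS _ (Sx (n + i)%N).
  by move=> /le_trans; apply; rewrite FS subrr (hform0l hB) mulr0 addr0.
have F_homo i j y : (i <= j)%N -> F i y <= F j y.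
  move=> /subnK <-; elim: (j - i)%N => [//|n ih]; apply: le_trans ih _.
  by rewrite addSn.
(* For [n < j], [F n.+1 (x j) <= F j (x j) <= F n (x n) <= F n (x j) + e n], and the outer terms
   differ by the penalty of stage [n] at [x j]. *)
have xdist n j : (n <= j)%N -> `|x n - x j| <= r * h n.
  rewrite leq_eqVlt => /predU1P[<-|nj].
    by rewrite subrr normr0 mulr_ge0 ?ltW.
  rewrite -ler_sqr ?nnegrE ?mulr_ge0 ?(ltW (h0 _)) ?(ltW r0)//.
  rewrite distrC (le_trans (hform_ge hB _))//.
  rewrite -(ler_pM2l (dh0 n)) -/(e n).
  have := F_homo _ _ (x j) nj; rewrite FS => F1.
  have F2 := Fx_anti _ _ (ltnW nj).
  have := xmin n (x j) (Sx j); lra.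
have /cvg_ex[v xv] : cvgn x.
  apply: cV => eps eps0.
  have /cvgrPdist_le/(_ (eps / r)) := hlim.
  rewrite divr_gt0// => /(_ isT)[N _ hN].
  exists N => n Nn; apply: le_trans (xdist _ _ Nn) _.
  have := hN N (leqnn N); rewrite /= sub0r normrN (ger0_norm (ltW (h0 _))).
  by rewrite ler_pdivlMr// mulrC.
have Sv : S v by apply: (closed_cvg S) xv => //; exact: nearW.
have vdist n : `|x n - v| <= r * h n.
  have : `|x n - x j| @[j --> \oo] --> `|x n - v|.
    by apply: cvg_norm; apply: cvgB => //; exact: cvg_cst.
  move=> /cvgr_to_le; apply; exists n => // j; exact: xdist.
have Fcont n : continuous (F n).
  elim: n => [|n ih]; first exact: cf.
  move=> y; apply: cvgD; first exact: ih.
  apply: cvgM; first exact: cvg_cst.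
  apply: (@continuous_comp _ _ _ (fun y => y - x n) (fun y => B y y)).
    by apply: cvgB; [exact: cvg_id|exact: cvg_cst].
  exact: hform_sq_continuous.
have Fv n : F n v <= F n (x n).
  have : F n (x j) @[j --> \oo] --> F n v.
    by apply: continuous_cvg => //; exact: Fcont.
  move=> /cvgr_to_le; apply; exists n => // j nj.
  exact: le_trans (F_homo _ _ _ nj) (Fx_anti _ _ nj).
have vmin n z : S z -> F n v <= F n z + e n.
  by move=> Sz; apply: le_trans (Fv n) (xmin _ _ Sz).
pose b n := \sum_(i < n) (d * h i) *: (v - x i).
have bS n : b n.+1 = b n + (d * h n) *: (v - x n) by rewrite /b big_ord_recr.
(* The first [n] weights sum to [2 * d * (1 - h n)]; recentring each penalty at [v] leaves the
   gradient [b n]. *)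
have Fdiff n z : F n z - F n v = f z - f v +
    2 * d * (1 - h n) * B (z - v) (z - v) + 2 * B (b n) (z - v).
  elim: n => [|n ih].
    rewrite /b big_ord0 (hform0l hB) /h expr0 subrr.
    by rewrite !(mul0r, mulr0) !addr0.
  rewrite !FS bS hS (hform_expand hB z (x n) v).
  rewrite (hformDl hB (b n)) (hformZl hB (d * h n)).
  rewrite (_ : F n z = F n v + (F n z - F n v)); last by ring.
  by rewrite ih; field.
(* Each increment of [b] has norm at most [d * h n * (r * h n) <= k * h n / 2 = k * (h n - h n.+1)],
   so the bounds telescope. *)
have bdist i j : (i <= j)%N -> `|b i - b j| <= k * (h i - h j).
  move=> /subnK <-; elim: (j - i)%N => [|n ih].
    by rewrite !subrr normr0 mulr0.
  rewrite addSn bS opprD addrA (le_trans (ler_normB _ _))//.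
  rewrite [leRHS](_ : _ = k * (h i - h (n + i)%N) + k * (h (n + i)%N / 2)).
    apply: lerD => //; rewrite normrZ (gtr0_norm (dh0 _)) distrC.
    apply: (@le_trans _ _ (d * h (n + i)%N * r)).
      rewrite ler_pM2l// (le_trans (vdist _))//.
      by rewrite ler_piMr// ltW.
    by rewrite -dr le_eqVlt; apply/predU1l; field.
  by rewrite hS; field.
have /cvg_ex[bl bbl] : cvgn b.
  apply: cV => eps eps0.
  have /cvgrPdist_le/(_ (eps / k)) := hlim.
  rewrite divr_gt0// => /(_ isT)[N _ hN].
  exists N => n Nn; apply: le_trans (bdist _ _ Nn) _.
  have := hN N (leqnn N); rewrite /= sub0r normrN (ger0_norm (ltW (h0 _))).
  rewrite ler_pdivlMr// mulrC; apply: le_trans.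
  by rewrite ler_pM2l// lerBlDr lerDl ltW.
exists v, bl, (2 * d); split=> //.
- by have := vdist 0%N; rewrite /h expr0 mulr1.
- have : `|b n| @[n --> \oo] --> `|bl| by exact: cvg_norm.
  move=> /cvgr_to_le; apply; exists 0%N => // n _.
  have := bdist 0%N n (leq0n n); rewrite /b big_ord0 sub0r normrN => /le_trans.
  by apply; rewrite ler_piMr ?ltW// /h expr0 ltrBlDr ltrDl.
- move=> z Sz.
  (* Let [n] tend to infinity in [vmin], rewritten by [Fdiff]; the tolerance [e n] is dominated by
     the vanishing last term. *)
  have L : f z + 2 * d * B (z - v) (z - v) + 2 * B (z - v) (b n) +
      d * r ^+ 2 * h n @[n --> \oo] -->
      f z + 2 * d * B (z - v) (z - v) + 2 * B (z - v) bl + d * r ^+ 2 * 0.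
    apply: cvgD; last by apply: cvgM => //; exact: cvg_cst.
    apply: cvgD; first exact: cvg_cst.
    apply: cvgM; first exact: cvg_cst.
    by apply: continuous_cvg => //; exact: hform_continuous.
  rewrite mulr0 addr0 (hformC hB (z - v)) in L.
  apply: (cvgr_to_ge L); exists 0%N => // n _.
  have := Fdiff n z; have := vmin n z Sz; have := ele n.
  rewrite (hformC hB (z - v)).
  have : 0 <= 2 * d * h n * B (z - v) (z - v).
    by rewrite mulr_ge0 ?(hform_ge0 hB)// -mulrA mulr_ge0// ltW.
  rewrite (mulrBr (2 * d)) mulr1 (mulrBl (B (z - v) (z - v))).
  lra.
Qed.

(** * Proximal normals at a minimizer of the penalty function *)

Definition proximal_normal {R : realType} {V : normedModType R}
    (B : V -> V -> R) (L : set V) (v p : V) : Prop :=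
  exists (K r : R), 0 < r /\ forall z, L z -> `|v - z| <= r ->
    B p (z - v) <= K * B (z - v) (z - v).

(** Concavity of the square root: multiplied by [2 * Num.sqrt b], the gap between the two sides is
    the square of [Num.sqrt a - Num.sqrt b]. *)
Lemma sqrt_tangent {R : realType} (a b : R) : 0 <= a -> 0 < b ->
  Num.sqrt a <= Num.sqrt b + (a - b) / (2 * Num.sqrt b).
Proof.
move=> a0 b0; have s0 : 0 < Num.sqrt b by rewrite sqrtr_gt0.
rewrite -lerBlDl ler_pdivlMr ?mulr_gt0//.
rewrite -{2}(sqr_sqrtr a0) -{3}(sqr_sqrtr (ltW b0)).
rewrite -subr_ge0 [leRHS](_ : _ = (Num.sqrt a - Num.sqrt b) ^+ 2) ?sqr_ge0//.
by ring.
Qed.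

(** The squared positive part is differentiable with derivative [2 * Num.max s 0], and its
    first-order expansion errs by at most [u ^+ 2]. *)
Lemma sqr_max0_le {R : realType} (s t u : R) : t <= s + u ->
  Num.max t 0 ^+ 2 <= Num.max s 0 ^+ 2 + 2 * Num.max s 0 * u + u ^+ 2.
Proof.
have [t0|t0] := leP t 0; have [s0|s0] := leP s 0 => tu; rewrite ?expr0n/=.
- by rewrite mulr0 mul0r !add0r sqr_ge0.
- by rewrite [leRHS](_ : _ = (s + u) ^+ 2) ?sqr_ge0//; ring.
- rewrite mulr0 mul0r !add0r ler_sqr ?nnegrE ?(ltW t0)//; lra.
- rewrite [leRHS](_ : _ = (s + u) ^+ 2); last by ring.
  rewrite ler_sqr ?nnegrE ?(ltW t0)//; lra.
Qed.

Section Penalization.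
Context {R : realType} {V : normedModType R} {B : V -> V -> R}.
Hypotheses (hB : hilbert_form B) (cV : seq_complete V).
Variables (Theta1 Theta2 : set V) (zb zs : V) (rho c k : R).
Hypotheses (rho0 : 0 < rho) (c0 : 0 < c) (k0 : 0 < k).
Hypotheses (zb1 : Theta1 zb) (zb2 : Theta2 zb).
Hypothesis cl1 : closed (Theta1 `&` [set z | `|zb - z| <= rho]).
Hypothesis cl2 : closed (Theta2 `&` [set z | `|zb - z| <= rho]).
Hypothesis zsP : forall z, Theta1 z -> Theta2 z -> `|zb - z| <= rho ->
  B zs (z - zb) <= c * Num.sqrt (B (z - zb) (z - zb)).

(** Makes [c * tau = k * (rho / 2) / 2], the initial gap allowed by [smooth_variational] with radius
    [rho / 2]. *)
Let tau := k * rho / (4 * c).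
Let h z := c * Num.sqrt (B (z - zb) (z - zb) + tau ^+ 2) - B zs (z - zb).
Let g (x : V * V) := B (x.1 - x.2) (x.1 - x.2) + Num.max (h x.2) 0 ^+ 2.
Let f x := Num.sqrt (g x).

Let tau0 : 0 < tau. Proof. by rewrite divr_gt0 ?mulr_gt0. Qed.

Let hcont : continuous h.
Proof.
have cB : continuous (fun z : V => z - zb).
  by move=> z; apply: cvgB; [exact: cvg_id|exact: cvg_cst].
move=> z; apply: cvgB; last first.
  apply: (@continuous_comp _ _ _ (fun z => z - zb) (B zs)); first exact: cB.
  exact: hform_continuous.
apply: cvgM; first exact: cvg_cst.
apply: (@continuous_comp _ _ _
  (fun z => B (z - zb) (z - zb) + tau ^+ 2) Num.sqrt); last exact: sqrt_continuous.
apply: cvgD; last exact: cvg_cst.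
apply: (@continuous_comp _ _ _ (fun z => z - zb) (fun y => B y y)).
  exact: cB.
exact: hform_sq_continuous.
Qed.

Let fcont : continuous f.
Proof.
move=> x; apply: (@continuous_comp _ _ _ g Num.sqrt); last exact: sqrt_continuous.
apply: cvgD.
  apply: (@continuous_comp _ _ _ (fun x : V * V => x.1 - x.2)
    (fun y => B y y)); last exact: hform_sq_continuous.
  by apply: cvgB; [exact: cvg_fst|exact: cvg_snd].
apply: (@continuous_comp _ _ _ (fun x : V * V => Num.max (h x.2) 0)
  (fun y : R => y ^+ 2)); last exact: exprn_continuous.
apply: (@continuous_comp _ _ _ (fun x : V * V => h x.2)
  (fun y : R => Num.max y 0)).
  by apply: (@continuous_comp _ _ _ snd h); [exact: cvg_snd|exact: hcont].
by apply: continuous_max; [exact: cvg_id|exact: cvg_cst].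
Qed.

Let S : set (V * V) := [set x |
  (Theta1 `&` [set z | `|zb - z| <= rho]) x.1 /\
  (Theta2 `&` [set z | `|zb - z| <= rho]) x.2].

Let Sclosed : closed S.
Proof.
apply: closedI.
  by apply: (@preimage_closed _ _ (@fst V V)) => // x _; exact: cvg_fst.
by apply: (@preimage_closed _ _ (@snd V V)) => // x _; exact: cvg_snd.
Qed.

(** If the distance term vanishes, the common point lies in both sets and [tau > 0] makes [h]
    strictly positive there. Thus the square root in [f] is only differentiated where it is
    smooth. *)
Let g_gt0 x : S x -> 0 < g x.
Proof.
move=> [[T1 r1] [T2 r2]].
have q0 := hform_ge0 hB (x.1 - x.2).
have m0 : 0 <= Num.max (h x.2) 0 ^+ 2 by exact: sqr_ge0.
rewrite lt_neqAle addr_ge0// andbT eq_sym paddr_eq0// negb_and -implyNb negbK.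
apply/implyP => /eqP q00.
have x12 : x.1 = x.2.
  apply/subr0_eq/eqP; rewrite -normr_eq0 -sqrf_eq0 eq_le sqr_ge0 andbT.
  by rewrite -q00 hform_ge.
have h_gt0 : 0 < h x.2.
  rewrite subr_gt0; apply: (le_lt_trans (zsP _ T2 r2)).
    by rewrite -x12.
  rewrite ltr_pM2l// ltr_sqrt ?ltrDl ?exprn_gt0//.
  by apply: ltr_wpDl; [exact: hform_ge0|rewrite exprn_gt0].
by rewrite sqrf_eq0 gt_eqF// lt_max h_gt0.
Qed.

(** Here [w] is the gradient at [v2] of the smoothed norm in [h], hence of length at most 1, and
    [2 *: b1], [2 *: b2] come from the variational perturbation. The normalization of [l] and [mu]
    is the definition of [phi ^+ 2] divided by [phi ^+ 2]. *)
Lemma fuzzy_sum_rule : exists (v1 v2 b1 b2 w : V) (l mu : R),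
  [/\ [/\ Theta1 v1, Theta2 v2, `|zb - v1| <= rho / 2 & `|zb - v2| <= rho / 2],
      [/\ `|b1| <= k, `|b2| <= k & B w w <= 1],
      [/\ 0 <= l, 0 < mu & l ^+ 2 + mu ^+ 2 * B (v1 - v2) (v1 - v2) = 1],
      proximal_normal B Theta1 v1 (mu *: (v2 - v1) - 2 *: b1) &
      proximal_normal B Theta2 v2
        (mu *: (v1 - v2) + l *: zs - (l * c) *: w - 2 *: b2)].
Proof.
have Szb : S (zb, zb).
  by rewrite /S /= subrr normr0 ltW.
have f0 : f (zb, zb) <= 0 + k * (rho / 2) / 2.
  have hzb : h zb = c * tau.
    rewrite /h !subrr (hformC hB zs) !(hform0l hB) add0r subr0 sqrtr_sqr.
    by rewrite ger0_norm// ltW.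
  have ct0 : 0 <= c * tau by rewrite mulr_ge0 ?ltW.
  rewrite /f /g /= hzb subrr (hform0l hB) !add0r (max_l ct0) sqrtr_sqr.
  rewrite (ger0_norm ct0) /tau le_eqVlt; apply/predU1l; field.
  by rewrite gt_eqF.
have fge0 x : S x -> 0 <= f x by move=> _; exact: sqrtr_ge0.
have rho2 : 0 < rho / 2 by rewrite divr_gt0.
have [[v1 v2] [[b1 b2] [d [Sv dv db vmin]]]] :=
  smooth_variational (prod_form hB hB) (prod_seq_complete cV cV)
    Sclosed fcont fge0 Szb k0 rho2 f0.
move: (Sv) => [[/= T1 r1] [T2 r2]].
have [dv1 dv2] : `|zb - v1| <= rho / 2 /\ `|zb - v2| <= rho / 2.
  by move: dv; rewrite prod_normE /= ge_max => /andP.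
have [db1 db2] : `|b1| <= k /\ `|b2| <= k.
  by move: db; rewrite prod_normE /= ge_max => /andP.
set A0 := g (v1, v2).
have A00 : 0 < A0 := g_gt0 Sv.
set phi := Num.sqrt A0.
have phi0 : 0 < phi by rewrite sqrtr_gt0.
set th := Num.max (h v2) 0.
have th0 : 0 <= th by rewrite le_max lexx orbT.
set sg := Num.sqrt (B (v2 - zb) (v2 - zb) + tau ^+ 2).
have sgA : 0 < B (v2 - zb) (v2 - zb) + tau ^+ 2.
  by rewrite ltr_wpDl ?(hform_ge0 hB)// exprn_gt0.
have sg0 : 0 < sg by rewrite sqrtr_gt0.
have sg2 : sg ^+ 2 = B (v2 - zb) (v2 - zb) + tau ^+ 2 by rewrite sqr_sqrtr// ltW.
have phi2 : phi ^+ 2 = B (v1 - v2) (v1 - v2) + th ^+ 2 by rewrite sqr_sqrtr// ltW.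
(* The minimizer stays within [rho / 2] of the centre, so a ball of radius [rho / 2] around each
   component is still admissible. *)
have near_rho v z : `|zb - v| <= rho / 2 -> `|v - z| <= rho / 2 -> `|zb - z| <= rho.
  by move=> h1 h2; rewrite (splitr rho) (le_trans (ler_distD v _ _))// lerD.
(* Bounding the square root by its tangent at [A0] turns minimality of the perturbed [f] into an
   inequality on [g]. *)
have gain x : S x -> 0 <= (g x - A0) / (2 * phi) +
    d * (B (x.1 - v1) (x.1 - v1) + B (x.2 - v2) (x.2 - v2)) +
    2 * (B b1 (x.1 - v1) + B b2 (x.2 - v2)).
  move=> Sx; have /= := vmin x Sx.
  have := sqrt_tangent (ltW (g_gt0 Sx)) A00.
  rewrite -/phi -/(f x) -[f (v1, v2)]/phi; lra.
exists v1, v2, b1, b2, (sg^-1 *: (v2 - zb)), (th / phi), phi^-1; split=> //.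
- split=> //; rewrite (hformZl hB) (hformZr hB) mulrA -expr2 exprVn sg2.
  by rewrite mulrC ler_pdivrMr// mul1r lerDl sqr_ge0.
- split; rewrite ?divr_ge0 ?invr_gt0 ?(ltW phi0)//.
  rewrite exprMn exprVn -mulrC -mulrDr addrC -phi2 mulVf//.
  by rewrite expf_neq0// gt_eqF.
(* Only the first component varies, so the term in [h] cancels and [g] is exactly quadratic. *)
- exists (phi^-1 / 2 + d), (rho / 2); split=> // z T1z zv.
  have /gain /= : S (z, v2) by split; split=> //=; exact: near_rho zv.
  rewrite {1}/A0 /g /= subrr (hform0l hB).
  rewrite !(hformC hB b2) (hform0l hB) (hform_expand hB z v2 v1).
  rewrite (hformBl hB (phi^-1 *: _)) !(hformZl hB) -(opprB v1 v2) (hformNl hB).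
  set Q := B (z - v1) (z - v1); set P := B (v1 - v2) (z - v1).
  rewrite (_ : (_ - _) / _ = phi^-1 / 2 * Q + phi^-1 * P); last first.
    by field; rewrite gt_eqF.
  lra.
(* Only the second component varies. [G] is the gradient of [h] at [v2], and [u z] is a quadratic
   upper bound for the increment of [h]. *)
- have [C C0 hC] := hform_le hB.
  pose u z := c * ((B (z - zb) (z - zb) - B (v2 - zb) (v2 - zb)) / (2 * sg)) -
    B zs (z - v2).
  pose G := (c / sg) *: (v2 - zb) - zs.
  pose e := c / (2 * sg).
  have uE z : u z = B G (z - v2) + e * B (z - v2) (z - v2).
    rewrite /u (hform_expand hB z zb v2) /G (hformBl hB (_ *: _)) (hformZl hB).
    by rewrite /e; field; rewrite gt_eqF.
  have hu z : h z <= h v2 + u z.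
    have : 0 <= B (z - zb) (z - zb) + tau ^+ 2.
      by rewrite addr_ge0 ?(hform_ge0 hB)// sqr_ge0.
    move=> /sqrt_tangent /(_ sgA); rewrite -/sg.
    rewrite (_ : _ + tau ^+ 2 - _ = B (z - zb) (z - zb) - B (v2 - zb) (v2 - zb)); last by ring.
    have hz : B zs (z - zb) = B zs (z - v2) + B zs (v2 - zb).
      by rewrite -(hformDr hB) subrKA.
    rewrite -(ler_pM2l c0) mulrDr /h -/sg /u hz; lra.
  (* Bounds [u z ^+ 2] by [M * Q], via [(p + q)^2 <= 2 p^2 + 2 q^2] and Cauchy-Schwarz; the quartic
     part needs [Q <= C], hence the radius at most 1. *)
  pose M := 2 * B G G + 2 * e ^+ 2 * C.
  exists (phi^-1 / 2 * (1 + 2 * th * e + M) + d), (Num.min (rho / 2) 1).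
  rewrite lt_min rho2 ltr01; split=> // z T2z.
  rewrite le_min => /andP[zv zv1].
  have grad y : B (phi^-1 *: (v1 - v2) + (th / phi) *: zs -
      (th / phi * c) *: (sg^-1 *: (v2 - zb)) - 2 *: b2) y =
      phi^-1 * (B (v1 - v2) y - th * B G y) - 2 * B b2 y.
    rewrite (hformBl hB _ (2 *: _)) (hformBl hB _ (_ *: (_ *: _))).
    rewrite (hformDl hB (_ *: _)) /G (hformBl hB (_ *: _)) !(hformZl hB).
    by field; rewrite !gt_eqF.
  have qv1 : B (v1 - z) (v1 - z) = B (v1 - v2) (v1 - v2) -
      2 * B (v1 - v2) (z - v2) + B (z - v2) (z - v2).
    rewrite (_ : v1 - z = (v1 - v2) - (z - v2)); last by rewrite opprB subrKA.
    rewrite !(hformBl hB (v1 - v2)) !(hformBr hB (v1 - v2)).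
    by rewrite (hformC hB (z - v2)); ring.
  set y := z - v2; set Q := B y y.
  have uQ : u z ^+ 2 <= M * Q.
    have QC : Q <= C.
      by rewrite (le_trans (hC _))// ler_piMr// distrC exprn_ile1.
    have Q0 : 0 <= Q := hform_ge0 hB _.
    have eQ : e ^+ 2 * Q * Q <= e ^+ 2 * C * Q.
      by rewrite ler_wpM2r// ler_wpM2l// sqr_ge0.
    have := hform_CS hB G y; have := sqr_ge0 (B G y - e * Q).
    rewrite uE -/y -/Q /M; lra.
  have /gain : S (v1, z) by split; split=> //=; exact: near_rho zv.
  rewrite {1}/A0 /g /= subrr (hformC hB b1) !(hform0l hB) qv1 -/th -/y -/Q => gz.
  have hz := sqr_max0_le (hu z); rewrite -/th in hz.
  have : Q - 2 * B (v1 - v2) y + Num.max (h z) 0 ^+ 2 - th ^+ 2 <=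
      Q - 2 * B (v1 - v2) y + 2 * th * (B G y + e * Q) + M * Q.
    by move: hz uQ; rewrite uE -/y -/Q; lra.
  have phiV : 0 < phi^-1 / 2 by rewrite divr_gt0// invr_gt0.
  rewrite -(ler_pM2l phiV) grad => le1; move: gz.
  rewrite (_ : (_ - _) / (2 * phi) = phi^-1 / 2 *
    (Q - 2 * B (v1 - v2) y + Num.max (h z) 0 ^+ 2 - th ^+ 2)); last first.
    by field; rewrite gt_eqF.
  lra.
Qed.
End Penalization.

(** * Normal cones in the product space and tangent cones to convex sets *)

Section Cones.
Context {R : realType} {X Y : hilbertType R}.
Implicit Types (z p v : X * Y) (L : set (X * Y)).

Lemma prod_inner_form : hilbert_form (@prod_inner R X Y).
Proof. exact: prod_form (inner_form X) (inner_form Y). Qed.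

Lemma prod_normS z : prod_norm z = Num.sqrt (prod_inner z z).
Proof.
rewrite /prod_norm /prod_inner !normr_inner !sqr_sqrtr//.
  exact: (hform_ge0 (inner_form Y)).
exact: (hform_ge0 (inner_form X)).
Qed.

Lemma sqr_prod_norm z : prod_norm z ^+ 2 = prod_inner z z.
Proof. by rewrite prod_normS sqr_sqrtr// (hform_ge0 prod_inner_form). Qed.

Lemma prod_norm_ge0 z : 0 <= prod_norm z.
Proof. exact: sqrtr_ge0. Qed.

Lemma prod_norm_ge z : `|z| <= prod_norm z.
Proof.
rewrite -ler_sqr ?nnegrE ?prod_norm_ge0// sqr_prod_norm.
exact: (hform_ge prod_inner_form).
Qed.

Lemma prod_norm_le z : prod_norm z <= 2 * `|z|.
Proof.
rewrite -ler_sqr ?nnegrE ?prod_norm_ge0 ?mulr_ge0// sqr_sqrtr; last first.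
  by rewrite addr_ge0// sqr_ge0.
rewrite exprMn prod_normE; set M := Num.max _ _.
have h1 : `|z.1| ^+ 2 <= M ^+ 2 by rewrite ler_sqr ?nnegrE ?le_max ?lexx ?normr_ge0.
have h2 : `|z.2| ^+ 2 <= M ^+ 2.
  by rewrite ler_sqr ?nnegrE ?le_max ?lexx ?normr_ge0 ?orbT.
have := sqr_ge0 M; lra.
Qed.

Lemma proximal_normalZ (a : R) L v p : 0 <= a ->
  proximal_normal (@prod_inner R X Y) L v p ->
  proximal_normal (@prod_inner R X Y) L v (a *: p).
Proof.
move=> a0 [K [r [r0 Kp]]]; exists (a * K), r; split=> // z Lz zr.
by rewrite (hformZl prod_inner_form) -mulrA ler_wpM2l// Kp.
Qed.

Lemma prod_closed_ballE z v (r : R) : 0 < r ->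
  (closed_ball v.1 r `*` closed_ball v.2 r) z <-> `|v - z| <= r.
Proof.
move=> r0; rewrite !closed_ballE// prod_normE ge_max /=.
by split=> [[-> ->]//|/andP].
Qed.

Lemma prod_normZ (a : R) z : prod_norm (a *: z) = `|a| * prod_norm z.
Proof.
rewrite !prod_normS (hformZl prod_inner_form) (hformZr prod_inner_form) mulrA.
by rewrite -expr2 sqrtrM ?sqr_ge0// sqrtr_sqr.
Qed.

(** After division by [prod_norm (z - v)] the quadratic bound is [K * prod_norm (z - v)], which
    tends to 0. *)
Lemma proximal_normal_cone L v p :
  proximal_normal (@prod_inner R X Y) L v p -> normal_cone v L p.
Proof.
move=> [K [r [r0 Kp]]]; rewrite /normal_cone /eps_normal_cone /= mul0r.
apply/lee_addgt0Pr => e e0; rewrite add0e.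
pose M := `|K| + 1.
have M0 : 0 < M by rewrite ltr_wpDl.
(* The 2 absorbs the passage from [prod_norm] to the sup norm, in which the neighbourhood is
   measured. *)
pose d := Num.min r (e / (2 * M)).
have d0 : 0 < d by rewrite lt_min r0 divr_gt0// mulr_gt0.
pose W : set (X * Y) := [set z | [/\ L z, z != v & `|v - z| <= d]].
apply: (@le_trans _ _ (ereal_sup [set
    (prod_inner p (z - v) / prod_norm (z - v))%:E | z in W])).
  apply: ereal_inf_lbound; exists W => //.
  have : \forall z \near v, `|v - z| <= d.
    exact: (@cvgr_dist_le _ _ _ _ _ id v cvg_id).
  by apply: filterS => z zd zv Lz; split.
apply: ge_ereal_sup => _ [z [Lz zv zd] <-]; rewrite lee_fin.
move: zd; rewrite le_min => /andP[zr zd].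
have n0 : 0 < prod_norm (z - v).
  by apply: lt_le_trans (prod_norm_ge _); rewrite normr_gt0 subr_eq0.
rewrite ler_pdivrMr// (le_trans (Kp z Lz zr))// -sqr_prod_norm expr2 mulrA.
rewrite ler_pM2r//.
apply: (@le_trans _ _ (M * prod_norm (z - v))).
  by rewrite ler_pM2r// (le_trans (ler_norm K))// lerDl.
apply: (@le_trans _ _ (M * (2 * `|z - v|))).
  by rewrite ler_pM2l// prod_norm_le.
by rewrite mulrCA mulrA [leLHS]mulrC distrC -ler_pdivlMr// mulr_gt0.
Qed.

Lemma eps_normal_cone_near (eps g : R) v L p :
  eps_normal_cone eps v L p -> 0 < g ->
  exists2 r : R, 0 < r & forall z, L z -> `|v - z| <= r ->
    prod_inner p (z - v) <= (eps * prod_norm p + g) * prod_norm (z - v).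
Proof.
move=> /le_lt_trans h g0.
have /h : ((eps * prod_norm p)%:E < (eps * prod_norm p + g)%:E)%E.
  by rewrite lte_fin ltrDl.
move=> /ereal_inf_lt[_ [W + <-] supW].
move=> /nbhs_ballP[r /= r0 rW].
exists (r / 2); first by rewrite divr_gt0.
move=> z Lz zr.
have [->|zv] := eqVneq z v.
  rewrite subrr (hformC prod_inner_form) (prod_normS 0).
  by rewrite !(hform0l prod_inner_form) sqrtr0 mulr0.
have Wz : W z.
  apply: rW => //; rewrite -ball_normE /=; apply: le_lt_trans zr _.
  by rewrite ltr_pdivrMr// ltr_pMr// ltr1n.
have n0 : 0 < prod_norm (z - v).
  by apply: lt_le_trans (prod_norm_ge _); rewrite normr_gt0 subr_eq0.
rewrite -ler_pdivrMr// -lee_fin; apply: le_trans (ltW supW).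
by apply: ereal_sup_ubound; exists z.
Qed.

(** All small radii are covered at once, because the final radius is a minimum of several
    constraints. *)
Lemma locally_closed_ball z L : locally_closed_at z L ->
  exists2 r : R, 0 < r &
    forall s, s <= r -> closed (L `&` [set y | `|z - y| <= s]).
Proof.
move=> [U zU cU]; have /nbhs_closedballP[r rU] := zU.
exists r%:num => // s sr.
rewrite (_ : _ `&` _ = (L `&` closure U) `&` [set y | `|z - y| <= s]).
  by apply: closedI => //; exact: closed_closed_ball_.
apply/seteqP; split=> y /= [Ly ys]; split=> //; last by case: Ly.
split=> //; apply: subset_closure; apply: rU.
by rewrite closed_ballE//=; exact: le_trans sr.
Qed.

Lemma convex_setP (O : set X) (a b : X) (l : R) : convex_set O ->
  O a -> O b -> 0 <= l -> l <= 1 -> O (l *: a + (1 - l) *: b).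
Proof.
move=> cO Oa Ob l0 l1.
have := cO a b (Itv01 l0 l1); rewrite !inE => h.
exact: h.
Qed.

(** By convexity the whole segment is feasible, so the constant direction [w] with steps [t / n.+1]
    is a witness. *)
Lemma tangent_feasible (O : set X) (a w : X) (t : R) : convex_set O ->
  O a -> 0 < t -> O (a + t *: w) -> tangent_cone a O w.
Proof.
move=> cO Oa t0 Ot; exists (fun n => t * n.+1%:R^-1), (fun=> w); split.
- by move=> n; rewrite mulr_gt0// invr_gt0.
- rewrite -[X in _ --> X](mulr0 t); apply: cvgM; first exact: cvg_cst.
  exact: cvg_harmonic.
- exact: cvg_cst.
- move=> n.
  have := @convex_setP O (a + t *: w) a n.+1%:R^-1 cO Ot Oa.
  rewrite invr_ge0 ler0n invf_le1 ?ler1n ?ltr0n// => /(_ isT isT).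
  by rewrite scalerDr scalerBl scale1r addrC addrA subrK scalerA mulrC.
Qed.

(** A step of length [1 / (s + t + 1)] from [a] in this direction reaches a convex combination of
    [p], [q] and [a]. It is formed in two stages, combining [q] with [a] first. *)
Lemma tangent_conic (O : set X) (a p q : X) (s t : R) : convex_set O ->
  O a -> O p -> O q -> 0 <= s -> 0 <= t ->
  tangent_cone a O (s *: (p - a) + t *: (q - a)).
Proof.
move=> cO Oa Op Oq s0 t0; set T := s + t + 1.
have T0 : 0 < T by rewrite ltr_wpDl ?addr_ge0.
have t1 : 0 < t + 1 by rewrite ltr_wpDl.
apply: (@tangent_feasible O a _ T^-1) => //; first by rewrite invr_gt0.
have Ob : O ((t / (t + 1)) *: q + (1 - t / (t + 1)) *: a).
  apply: convex_setP => //; first by rewrite divr_ge0 ?(ltW t1).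
  by rewrite ler_pdivrMr// mul1r lerDl.
rewrite [X in O X](_ : _ = (s / T) *: p +
    (1 - s / T) *: ((t / (t + 1)) *: q + (1 - t / (t + 1)) *: a)).
  apply: convex_setP => //; first by rewrite divr_ge0 ?(ltW T0).
  by rewrite ler_pdivrMr// mul1r /T -addrA lerDl addr_ge0.
rewrite !scalerDr !scalerN !scalerA.
rewrite (_ : (1 - s / T) * (t / (t + 1)) = T^-1 * t); last first.
  by rewrite /T; field; rewrite !gt_eqF.
rewrite (_ : (1 - s / T) * (1 - t / (t + 1)) = 1 - T^-1 * s - T^-1 * t); last first.
  by rewrite /T; field; rewrite !gt_eqF.
rewrite !scalerBl scale1r (mulrC s).
by rewrite addrACA [LHS]addrCA [RHS]addrA -(addrA a).
Qed.
End Cones.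

(** * Normalizing the multipliers and restoring tangency to [Omega] *)

Theorem theorem6p3 (R : realType) (X Y : hilbertType R)
    (Theta1 Theta2 : set (X * Y)) (Omega : set X) (xb : X) (yb : Y)
    (zb_in : (Theta1 `&` Theta2) (xb, yb))
    (lc1 : locally_closed_at (xb, yb) Theta1)
    (lc2 : locally_closed_at (xb, yb) Theta2)
    (cOmega : closed Omega) (cvxOmega : convex_set Omega)
    (projOmega : fst @` (Theta1 `|` Theta2) `<=` Omega)
    (eps : R) (eps_gt0 : 0 < eps) (eps_lt1 : eps < 1)
    (xs : X) (ys : Y)
    (zs_in : (eps_normal_cone eps (xb, yb) (Theta1 `&` Theta2) `&`
              (tangent_cone xb Omega `*` [set: Y])) (xs, ys))
    (nu : R) (nu_gt0 : 0 < nu) :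
  exists (lambda : R) (x1 x2 : X) (y1 y2 : Y) (xs1 xs2 : X) (ys1 ys2 : Y),
    [/\ 0 <= lambda,
        (Theta1 `&` (closed_ball xb nu `*` closed_ball yb nu)) (x1, y1) /\
        (Theta2 `&` (closed_ball xb nu `*` closed_ball yb nu)) (x2, y2),
        let r := (prod_norm (xs, ys) + nu) * eps in
        (minkowski_sum (normal_cone (x1, y1) Theta1)
             (closed_ball 0 r `*` closed_ball 0 r) `&`
           (tangent_cone x1 Omega `*` [set: Y])) (xs1, ys1) /\
        (minkowski_sum (normal_cone (x2, y2) Theta2)
             (closed_ball 0 r `*` closed_ball 0 r) `&`
           (tangent_cone x2 Omega `*` [set: Y])) (xs2, ys2),
        (closed_ball 0 nu `*` closed_ball 0 nu)
          (lambda *: (xs, ys) - (xs1, ys1) - (xs2, ys2)) &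
        Num.max lambda (prod_norm (xs1, ys1)) = 1].

Proof.
case: zs_in => Nzs [/= [t [u [t0 _ uxs Ou]]] _].
set zs := (xs, ys) in Nzs *; set zb := (xb, yb) in zb_in lc1 lc2 Nzs *.
have hP := @prod_inner_form R X Y.
(* The unit of error: the allowed radius is [eps * prod_norm zs + 8 * g], and the errors below use
   at most [7 * g] of the excess. *)
pose g := eps * nu / 8.
have g0 : 0 < g by rewrite divr_gt0// mulr_gt0.
have gnu : 2 * g <= nu.
  rewrite /g; have : eps * nu <= nu by rewrite ler_piMl// ltW.
  lra.
pose c := eps * prod_norm zs + g.
have c0 : 0 < c by rewrite ltr_wpDl// mulr_ge0 ?prod_norm_ge0// ltW.
have [N _ /(_ N (leqnn N)) /= uN] : \forall n \near \oo, `|xs - u n| <= g.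
  exact: cvgr_dist_le uxs _ g0.
have [r1 r10 cl1] := locally_closed_ball lc1.
have [r2 r20 cl2] := locally_closed_ball lc2.
have [r3 r30 zsP] := eps_normal_cone_near Nzs g0.
(* The index [N] is fixed first; the last entry keeps the displacement of [v2] from [zb] below [g]
   after division by [t N]. *)
pose rho := Num.min (Num.min r1 r2) (Num.min r3 (Num.min nu (t N * g))).
have rho0 : 0 < rho by rewrite !lt_min r10 r20 r30 nu_gt0 mulr_gt0.
have : rho <= rho by [].
rewrite {2}/rho !le_min => /andP[/andP[rr1 rr2] /and3P[rr3 rrnu rrt]].
have zsP' z : Theta1 z -> Theta2 z -> `|zb - z| <= rho ->
    prod_inner zs (z - zb) <= c * Num.sqrt (prod_inner (z - zb) (z - zb)).
  by move=> T1 T2 zr; rewrite -prod_normS zsP//; exact: le_trans zr _.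
have cplt : seq_complete (X * Y)%type.
  by apply: prod_seq_complete; exact: complete_seq_complete.
have [v1 [v2 [b1 [b2 [w [l [mu [[T1 T2 d1 d2] [k1 k2 ww] [l0 mu0 lmu] P1 P2]]]]]]]] :=
  fuzzy_sum_rule hP cplt rho0 c0 g0 zb_in.1 zb_in.2 (cl1 _ rr1) (cl2 _ rr2) zsP'.
have rho_nu v : `|zb - v| <= rho / 2 -> `|zb - v| <= nu.
  by move=> /le_trans; apply; lra.
pose a := mu * prod_norm (v1 - v2).
have a0 : 0 <= a by rewrite mulr_ge0 ?prod_norm_ge0// ltW.
have la : l ^+ 2 + a ^+ 2 = 1 by rewrite /a exprMn sqr_prod_norm.
(* Dividing by [m] gives the required normalization. Since [l ^+ 2 + a ^+ 2 = 1], [m] is at least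
   1/2 and errors grow at most twofold. *)
pose m := Num.max l a.
have lm : l <= m by rewrite le_max lexx.
have m2 : 2^-1 <= m.
  rewrite leNgt; apply/negP; rewrite gt_max => /andP[]; nra.
have m0 : 0 < m by apply: lt_le_trans m2; rewrite invr_gt0.
have mV2 : m^-1 <= 2 by rewrite -[leRHS]invrK lef_pV2// posrE invr_gt0.
have mV0 : 0 < m^-1 by rewrite invr_gt0.
pose lam := l / m.
have lam0 : 0 <= lam by rewrite divr_ge0 ?(ltW m0).
have lam1 : lam <= 1 by rewrite ler_pdivrMr// mul1r.
pose pt := xb + t N *: u N.
(* Substitute for [zs] whose first component points from [v2.1] to the feasible point [pt]; the
   second component needs no change. *)
pose W : X * Y := ((t N)^-1 *: (pt - v2.1), ys).
have Wzs : `|W - zs| <= 2 * g.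
  rewrite prod_normE /= subrr normr0 max_l//.
  have -> : (t N)^-1 *: (pt - v2.1) - xs =
      (t N)^-1 *: (xb - v2.1) - (xs - u N).
    rewrite /pt addrAC scalerDr scalerA mulVf ?gt_eqF// scale1r.
    by rewrite opprB addrA.
  rewrite (le_trans (ler_normB _ _))// mulr_natl mulr2n lerD//.
  rewrite normrZ gtr0_norm ?invr_gt0// ler_pdivrMl//.
  apply: (@le_trans _ _ `|zb - v2|); first by rewrite prod_normE le_max lexx.
  by rewrite (le_trans d2)//; lra.
pose Z1 := (mu / m) *: (v2 - v1).
pose Z2 := (mu / m) *: (v1 - v2) + lam *: W.
have mum0 : 0 <= mu / m by rewrite divr_ge0 ?ltW.
have O1 : Omega v1.1 by apply: projOmega; exists v1 => //; left.
have O2 : Omega v2.1 by apply: projOmega; exists v2 => //; right.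
pose r := (prod_norm zs + nu) * eps.
have r0 : 0 < r by rewrite mulr_gt0// ltr_wpDl ?prod_norm_ge0.
have bP (b : X * Y) : `|b| <= g -> `|(m^-1 * 2) *: b| <= 4 * g.
  move=> bg; rewrite normrZ ger0_norm ?mulr_ge0 ?(ltW mV0)//.
  by apply: ler_pM => //; rewrite ?mulr_ge0 ?(ltW mV0)//; lra.
have r8 : r = eps * prod_norm zs + 8 * g by rewrite /r /g; field.
have epn : 0 <= eps * prod_norm zs by rewrite mulr_ge0 ?prod_norm_ge0// ltW.
have minkP (Th : set (X * Y)) (v p Z : X * Y) :
    proximal_normal (@prod_inner R X Y) Th v p -> `|Z - p| <= r ->
    minkowski_sum (normal_cone v Th) (closed_ball 0 r `*` closed_ball 0 r) Z.
  move=> Pp Zp; exists p; first exact: proximal_normal_cone.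
  exists (Z - p); last by rewrite addrC subrK.
  by apply/(@prod_closed_ballE _ _ _ _ 0) => //; rewrite sub0r normrN.
exists lam, v1.1, v2.1, v1.2, v2.2, Z1.1, Z2.1, Z1.2, Z2.2.
rewrite -!surjective_pairing; split=> //.
- split; split=> //; apply/(@prod_closed_ballE _ _ _ _ zb) => //; exact: rho_nu.
- rewrite -/zs -/r /=; split; split.
  + apply: (minkP _ _ _ _ (proximal_normalZ (ltW mV0) P1)).
    rewrite scalerBr !scalerA (mulrC m^-1 mu) opprB addrC subrK.
    by rewrite (le_trans (bP _ k1))// r8; lra.
  + split=> //=; rewrite -[X in tangent_cone _ _ X]addr0 -(scale0r (v2.1 - v1.1)).
    exact: tangent_conic.
  + apply: (minkP _ _ _ _ (proximal_normalZ (ltW mV0) P2)).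
    (* The three errors are the tangency correction, the gradient of the smoothed norm and the
       variational perturbation, of size at most [2 * g], [c] and [4 * g]. *)
    have -> : Z2 - m^-1 *: (mu *: (v1 - v2) + l *: zs - (l * c) *: w - 2 *: b2)
        = lam *: (W - zs) + (lam * c) *: w + (m^-1 * 2) *: b2.
      rewrite (scalerBr _ _ (2 *: b2)) (scalerBr _ _ ((l * c) *: w)) scalerDr.
      rewrite !scalerA !opprD !opprK (mulrA m^-1) !(mulrC m^-1 _) -/lam.
      rewrite !addrA /Z2 [_ *: (v1 - v2) + _]addrC addrK.
      by rewrite scalerBr.
    have wn : `|w| <= 1.
      rewrite (le_trans (prod_norm_ge _))// -(ler_sqr (x := prod_norm w)).
      - by rewrite expr1n sqr_prod_norm.
      - by rewrite nnegrE prod_norm_ge0.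
      - by rewrite nnegrE.
    have n1 : `|lam *: (W - zs)| <= 2 * g.
      by rewrite normrZ ger0_norm// (le_trans (ler_piMl _ lam1)).
    have n2 : `|(lam * c) *: w| <= c.
      rewrite normrZ ger0_norm; last by apply: mulr_ge0; rewrite // ltW.
      by rewrite mulrAC ler_piMl ?(ltW c0)// mulr_ile1.
    rewrite (le_trans (ler_normD _ _))// r8.
    have := ler_normD (lam *: (W - zs)) ((lam * c) *: w); have := bP _ k2.
    move: n1 n2; rewrite /c; lra.
  + split=> //=; rewrite scalerA; apply: tangent_conic => //; first exact: Ou.
    by rewrite divr_ge0// ltW.
(* The opposite [mu] terms of [Z1] and [Z2] cancel, leaving [lam *: (zs - W)]. *)
- suff : `|0 - (lam *: zs - Z1 - Z2)| <= nu.
    by move=> /(@prod_closed_ballE _ X Y (lam *: zs - Z1 - Z2) 0 nu nu_gt0).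
  rewrite sub0r normrN /Z1 /Z2 -(opprB v1 v2) scalerN opprK opprD addrA addrK.
  rewrite -scalerBr.
  rewrite normrZ ger0_norm// distrC (le_trans _ gnu)//.
  by rewrite (le_trans (ler_piMl _ lam1)).
(* The norm of [Z1] is [a / m], so the maximum is [m / m]. *)
- rewrite /Z1 prod_normZ ger0_norm// -(opprB v1) -scaleN1r prod_normZ normrN1.
  by rewrite mul1r mulrAC -maxr_pMl ?(ltW mV0)// divff// gt_eqF.
Qed.
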